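(* Let $G$ be a finitely generated group, let $\varphi:G\times X\to X$ be a continuous action on a compact metric space $(X,d)$, and let $\mu$ be a Borel probability measure on $X$. Then $\mu(\overline{PSh(\varphi)})=1$ if and only if $\mu\in\overline{\mathcal{M}_{PSh}(X,\varphi)}$.
   Context: Fix a finite generating set $S$ of $G$ (discrete topology). For continuous actions $\varphi,\psi$ of $G$ on $X$ put $d_S(\varphi,\psi)=\sup\{d(\varphi(s,x),\psi(s,x)): x\in X, s\in S\}$. A map $f:G\to X$ is a $\delta$-pseudo orbit for $\psi$ if $d(f(sg),\psi(s,f(g)))<\delta$ for all $s\in S$, $g\in G$; it is $(\psi,\epsilon)$-shadowed by $p\in X$ if $d(f(g),\psi(g,p))<\epsilon$ for all $g\in G$. $Sh_\psi(\delta,\epsilon)$ is the set of $x\in X$ such that every $\delta$-pseudo orbit $f$ for $\psi$ with $f(e)=x$ is $(\psi,\epsilon)$-shadowed by a point of $X$. $PSh(\varphi)$ is the set of persistent shadowable points: $x\in X$ such that for every $\epsilon>0$ there is $\delta>0$ such that for every continuous action $\psi:G\times X\to X$ with $d_S(\varphi,\psi)<\delta$, every $\delta$-pseudo orbit $f$ for $\psi$ with $f(e)=x$ is $(\psi,\epsilon)$-shadowed by a point of $X$. $\mathcal{M}(X)$ is the set of Borel probability measures on $X$ with the weak$^*$ topology, and closures of subsets of $\mathcal{M}(X)$ are taken in it. $\mathcal{M}_{PSh}(X,\varphi)$ is the set of $\mu\in\mathcal{M}(X)$ such that for every $\epsilon>0$ there is $\delta>0$ such that for every Borel set $A\subseteq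 X$ with $\mu(A)>0$ one has $A\cap Sh_\psi(\delta,\epsilon)\neq\emptyset$ for every continuous action $\psi:G\times X\to X$ with $d_S(\varphi,\psi)<\delta$. *)

(* Defs.v *)
From HB Require Import structures.
From mathcomp Require Import all_boot all_order all_algebra.
From mathcomp Require Import all_classical all_reals all_analysis.

Set Implicit Arguments.
Unset Strict Implicit.
Unset Printing Implicit Defensive.

Import Order.TTheory GRing.Theory Num.Theory.
Import numFieldNormedType.Exports.

Local Open Scope classical_set_scope.
Local Open Scope ring_scope.

(* A metric space with a distinguished point. The point plays no role in the
   definitions below; it is there because every measurableType of the library
   is pointed. A space carrying a probability measure is nonempty anyway. *)
#[short(type="pmetricType")]
HB.structure Definition PointedMetric (R : numDomainType) :=
  { X of Metric R X & Pointed X }.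

Section FinitelyGeneratedGroups.
Context {G : groupType}.

Definition subgroup_set (H : set G) : Prop :=
  [/\ H 1%g,
      forall g h, H g -> H h -> H (g * h)%g
    & forall g, H g -> H (g^-1)%g].

Definition finite_generating_set (S : set G) : Prop :=
  finite_set S /\ smallest subgroup_set S = [set: G].

End FinitelyGeneratedGroups.

Section Actions.
Context {R : realType} {G : groupType} {X : pmetricType R}.

Definition continuous_action (phi : G -> X -> X) : Prop :=
  [/\ continuous (fun p : discrete_topology G * X => phi p.1 p.2),
      forall x, phi 1%g x = x
    & forall g h x, phi (g * h)%g x = phi g (phi h x)].

(* The real-valued sup is 0 on the empty set (S = set0 generates the trivial
   group) and on unbounded sets; the latter do not occur on a compact X. *)
Definition action_dist (S : set G) (phi psi : G -> X -> X) : R :=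
  sup [set r | exists s x, S s /\ r = mdist (phi s x) (psi s x)].

Definition pseudo_orbit (S : set G) (psi : G -> X -> X) (delta : R)
    (f : G -> X) : Prop :=
  forall s g, S s -> mdist (f (s * g)%g) (psi s (f g)) < delta.

Definition shadowed (psi : G -> X -> X) (epsilon : R) (f : G -> X) (p : X) :
    Prop :=
  forall g, mdist (f g) (psi g p) < epsilon.

Definition Sh (S : set G) (psi : G -> X -> X) (delta epsilon : R) : set X :=
  [set x | forall f : G -> X, pseudo_orbit S psi delta f -> f 1%g = x ->
           exists p, shadowed psi epsilon f p].

Definition PSh (S : set G) (phi : G -> X -> X) : set X :=
  [set x | forall epsilon : R, 0 < epsilon ->
    exists2 delta : R, 0 < delta &
      forall psi, continuous_action psi -> action_dist S phi psi < delta ->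
      forall f : G -> X, pseudo_orbit S psi delta f -> f 1%g = x ->
      exists p, shadowed psi epsilon f p].

End Actions.

Section BorelProbabilities.
Context {R : realType} (X : pmetricType R).

Definition borel : measurableType (@open X).-sigma :=
  g_sigma_algebraType (@open X).

Definition integrals (mu : probability borel R) :
    {ptws continuousType X R -> R} :=
  fun f => \int[mu]_x f x.

(* The weak* topology is the coarsest one making mu |-> \int f dmu continuous
   for every continuous f : X -> R. *)
Definition borel_probability : topologicalType := initial_topology integrals.

End BorelProbabilities.

Definition M_PSh {R : realType} {G : groupType} {X : pmetricType R}
    (S : set G) (phi : G -> X -> X) : set (borel_probability X) :=
  [set mu : probability (borel X) R | forall epsilon : R, 0 < epsilon ->
    exists2 delta : R, 0 < delta &
      forall A : set (borel X), measurable A -> (0 < mu A)%E ->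
      forall psi, continuous_action psi -> action_dist S phi psi < delta ->
      A `&` Sh S psi delta epsilon !=set0].

(* Main.v *)
Require Import Defs.
From mathcomp Require Import all_boot all_order all_algebra.
From mathcomp Require Import all_classical all_reals all_analysis.
From mathcomp Require Import measurable_realfun lra.

(** Write P for PSh(phi).

    If mu is a weak* limit of measures of M_PSh, then every nu in M_PSh gives
    mass 0 to the open set X \ cl P: by [M_PSh_null], each point x outside P
    has a nu-null neighbourhood.  Otherwise every neighbourhood of x would meet
    Sh_psi(delta, epsilon) for all psi close to phi, and a pseudo orbit
    starting at x could be restarted at a nearby point of that set without
    spoiling it, so that x would be persistently shadowable
    ([PSh_of_adherent_Sh]).  Vanishing on a given open set passes to weak*
    limits ([closure_null_open]), hence mu(X \ cl P) = 0.

    Conversely, a measure carried by finitely many points of P lies in M_PSh,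
    because finitely many deltas have a positive minimum
    ([M_PSh_distribution]).  If mu(cl P) = 1, there are Borel maps T_n
    with finitely many values, all in P, that move no point of cl P by
    more than 1/(n+1) ([finite_valued_approximation]); the images of mu under
    the T_n converge to mu by dominated convergence ([cvg_distribution]). *)

Set Implicit Arguments.
Unset Strict Implicit.
Unset Printing Implicit Defensive.

Import Order.TTheory GRing.Theory Num.Theory.
Import numFieldNormedType.Exports.

Local Open Scope classical_set_scope.
Local Open Scope ring_scope.

(** * The metric *)

Lemma ler_dist_mdist (R : realFieldType) (X : metricType R) (a x y : X) :
  `|mdist a x - mdist a y| <= mdist x y.
Proof.
have := metric_triangle a y x; have := metric_triangle a x y.
by rewrite (metric_sym y) ler_norml; lra.
Qed.

Lemma near_mdist (R : realFieldType) (X : metricType R) (x : X) (e : R) :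
  0 < e -> \forall y \near x, mdist x y < e.
Proof.
by move=> e0; have := nbhsx_ballx x e e0; rewrite ballEmdist.
Qed.

Lemma continuous_mdist (R : realType) (X : metricType R) (a : X) :
  continuous (mdist a : X -> R).
Proof.
move=> x; apply/cvgrPdist_lt => e e0.
apply: filterS (near_mdist x e0) => y; apply: le_lt_trans.
exact: ler_dist_mdist.
Qed.

Lemma compact_mdist_bounded (R : realType) (X : pmetricType R) :
  compact [set: X] -> exists M : R, forall x y : X, mdist x y <= M.
Proof.
move=> cX.
have /compact_bounded[M [_ hM]] :
    compact ((mdist (point : X) : X -> R) @` [set: X]).
  apply: continuous_compact => //.
  by apply: continuous_subspaceT; exact: continuous_mdist.
have {}hM x : mdist (point : X) x <= M + 1.
  rewrite (le_trans (ler_norm _))//.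
  by apply: (hM (M + 1)); [rewrite ltrDl|exists x].
exists ((M + 1) + (M + 1)) => x y.
by rewrite (le_trans (metric_triangle _ point _))// lerD// metric_sym.
Qed.

(** * Pseudo orbits and persistent shadowing *)

Section Dynamics.
Context {R : realType} {G : groupType} {X : pmetricType R}.
Implicit Types (S : set G) (phi psi : G -> X -> X).

Lemma mdist_le_action_dist S phi psi s x : compact [set: X] -> S s ->
  mdist (phi s x) (psi s x) <= action_dist S phi psi.
Proof.
move=> /compact_mdist_bounded[M hM] Ss; apply: ub_le_sup.
  by exists M => _ [t [y [_ ->]]]; exact: hM.
by exists s, x.
Qed.

Lemma continuous_action_at phi g :
  continuous_action phi -> continuous (phi g).
Proof.
case=> cphi _ _ x.
apply: (@continuous_comp X (discrete_topology G * X)%type X (pair g)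
  (fun p => phi p.1 p.2)); last exact: cphi.
by apply: (@cvg_pair X (discrete_topology G) X (nbhs x)
  (nbhs (g : discrete_topology G)) (nbhs x)); [exact: cvg_cst|exact: cvg_id].
Qed.

Lemma pseudo_orbitW S psi d d' f :
  d <= d' -> pseudo_orbit S psi d f -> pseudo_orbit S psi d' f.
Proof. by move=> dd' h s g /h /lt_le_trans; exact. Qed.

(** Only the steps that leave or reach the identity see the new value: a step
    s leaving it costs the displacement of psi s, a step reaching it costs
    the displacement of the point itself. *)
Lemma pseudo_orbit_change_start S psi d e f y :
    pseudo_orbit S psi d f -> continuous_action psi -> 0 < d + e ->
    (forall s, S s -> mdist (psi s (f 1%g)) (psi s y) < e) ->
    mdist (f 1%g) y < e ->
  pseudo_orbit S psi (d + e) (fun g => if g == 1%g then y else f g).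
Proof.
move=> pf [_ p1 _] de0 psiy fy s g Ss.
have [sg1|sg1] := eqVneq (s * g)%g 1%g; have [g1|g1] := eqVneq g 1%g.
- have s1 : s = 1%g by rewrite -sg1 g1 mulg1.
  by rewrite s1 p1 mdistxx.
- rewrite (le_lt_trans (metric_triangle _ (f 1%g) _))// addrC ltrD//.
    by rewrite -sg1; exact: pf.
  by rewrite metric_sym.
- rewrite (le_lt_trans (metric_triangle _ (psi s (f 1%g)) _))//.
  rewrite ltrD//; last exact: psiy.
  by have := pf s g Ss; rewrite {2}g1.
- rewrite (lt_le_trans (pf _ _ Ss))// lerDl.
  by rewrite (le_trans (mdist_ge0 (f 1%g) y))// ltW.
Qed.

(** The point x need not lie in any Sh psi d e, but a pseudo orbit starting at
    x can be restarted at a point y of that set close to x.  How close is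
    dictated by phi and the finitely many elements of S alone: each psi s is
    uniformly within d / 4 of phi s, so that psi s y is near psi s x as soon as
    phi s y is near phi s x.  The four errors d / 4 (that of the given pseudo
    orbit, two for passing between psi and phi, one for phi) add up to d. *)
Lemma PSh_of_adherent_Sh S phi x :
    compact [set: X] -> finite_set S -> continuous_action phi ->
    (forall e : R, 0 < e -> exists2 d : R, 0 < d &
       forall psi, continuous_action psi -> action_dist S phi psi < d ->
       closure (Sh S psi d e) x) ->
  PSh S phi x.
Proof.
move=> cX fS cphi adh e e0.
have e20 : 0 < e / 2 by rewrite divr_gt0.
have [d d0 hd] := adh _ e20.
have d40 : 0 < d / 4 by rewrite divr_gt0.
exists (d / 4) => // psi cpsi dpsi f pf fx.
have dd : d / 4 <= d by lra.
have dpsid : action_dist S phi psi < d by exact: lt_le_trans dpsi dd.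
have nU : nbhs x [set y |
    (forall s, S s -> mdist (phi s x) (phi s y) < d / 4) /\
    mdist x y < Num.min (d / 4) (e / 2)].
  apply: filterI; last first.
    by apply: near_mdist; rewrite lt_min d40.
  have [s' ->] := finite_fsetP.1 fS.
  apply: (@filter_bigI _ _ s'
    (fun s => [set y | mdist (phi s x) (phi s y) < d / 4])).
  move=> s _.
  exact: (continuous_action_at (g := s) cphi (near_mdist (phi s x) d40)).
have [y [Shy [phiy]]] := hd _ cpsi dpsid _ nU.
rewrite lt_min => /andP[xyd xye].
have orb : pseudo_orbit S psi d (fun g => if g == 1%g then y else f g).
  have -> : d = d / 4 + d * (3 / 4) by lra.
  apply: pseudo_orbit_change_start => //; rewrite ?fx; [lra| |lra].
  move=> s Ss; have := phiy s Ss.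
  have := metric_triangle (psi s x) (phi s x) (psi s y).
  have := metric_triangle (phi s x) (phi s y) (psi s y).
  have := mdist_le_action_dist phi psi x cX Ss.
  have := mdist_le_action_dist phi psi y cX Ss.
  by rewrite (metric_sym (psi s x) (phi s x)); lra.
have [|p hp] := Shy _ orb; first by rewrite eqxx.
(* Away from the identity the new pseudo orbit is f; at the identity the
   distance from x to y takes the other half of e. *)
exists p => g; have := hp g; have [->|_] := eqVneq g 1%g; last by lra.
by have := metric_triangle x y (psi 1%g p); rewrite fx; lra.
Qed.
End Dynamics.

(** * Borel measures and the weak* topology *)

Section BorelMeasures.
Context {R : realType} {X : pmetricType R}.
Implicit Types (mu nu : probability (borel X) R).

Lemma measurable_open_borel (U : set X) :
  open U -> measurable (U : set (borel X)).
Proof. exact: sub_sigma_algebra. Qed.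

Lemma measurable_closed_borel (C : set X) :
  closed C -> measurable (C : set (borel X)).
Proof.
move=> /closed_openC/measurable_open_borel/measurableC.
by rewrite setCK.
Qed.

Lemma continuous_measurable_borel (f : X -> R) :
  continuous f -> measurable_fun [set: borel X] (f : borel X -> R).
Proof.
move=> /continuousP cf; apply: (measurability _ (RGenOpens.measurableE R)).
move=> _ [_ [a [b ->] <-]]; rewrite setTI.
by apply: measurable_open_borel; apply: cf; exact: interval_open.
Qed.

(** Compact metric spaces are second countable: U is covered by the countably
    many null members of a countable basis. *)
Lemma locally_null mu (U : set X) : compact [set: X] -> open U ->
  (forall x, U x -> exists V : set X, [/\ open V, V x & mu V = 0%E]) ->
  mu U = 0%E.
Proof.
move=> cX oU hU; apply/eqP; rewrite -measure_le0.
have [B cB [Bo Bn]] := compact_second_countable cX.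
pose N := [set b : set X | B b /\ mu b = 0%E].
have cN : countable N by apply: sub_countable cB; apply: subset_card_le => b [].
have mN : measurable (\bigcup_(b in N) b : set (borel X)).
  apply: measurable_open_borel; apply: bigcup_open => b [Bb _]; exact: Bo.
have /measure_negligible-/(_ mN) N0 : mu.-negligible (\bigcup_(b in N) b).
  (* N is indexed by the values of an injection c into nat; the indices that
     are not values contribute the empty set. *)
  have /countable_injP[c cinj] := cN.
  pose F k : set (borel X) := \bigcup_(b in [set b | N b /\ c b = k]) b.
  have -> : \bigcup_(b in N) b = \bigcup_k F k.
    apply/seteqP; split=> [x [b Nb bx]|x [k _ [b [Nb _] bx]]]; last by exists b.
    by exists (c b) => //; exists b.
  apply: negligible_bigcup => k.
  have [[b [Nb cb]]|noF] := pselect (exists b, N b /\ c b = k).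
    suff -> : F k = b.
      case: Nb => Bb b0; exists b; split=> //.
      by apply: measurable_open_borel; exact: Bo.
    apply/seteqP; split=> [x [b' [Nb' cb'] b'x]|x bx]; last by exists b.
    by rewrite -(cinj b' b) ?inE// cb' cb.
  suff -> : F k = set0 by exact: negligible_set0.
  by rewrite -subset0 => x [b [Nb cb] _]; apply: noF; exists b.
rewrite -N0 le_measure ?inE//; first exact: measurable_open_borel.
move=> x /hU[V [oV Vx V0]].
have [b [Bb bx] bV] := Bn x V (open_nbhs_nbhs (conj oV Vx)).
exists b => //; split=> //; apply/eqP; rewrite -measure_le0 -V0.
by rewrite le_measure ?inE//; apply: measurable_open_borel => //; exact: Bo.
Qed.

Lemma integrable_continuous mu (f : X -> R) :
  compact [set: X] -> continuous f ->
  mu.-integrable [set: borel X] (EFin \o f).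
Proof.
move=> cX cf; apply: measurable_bounded_integrable => //.
- by rewrite (le_lt_trans (probability_le1 _ _))// ltry.
- exact: continuous_measurable_borel.
- have /compact_bounded[M [_ hM]] : compact (f @` [set: X]).
    by apply: continuous_compact => //; exact: continuous_subspaceT.
  by exists M; split; [exact: num_real|move=> N /hM h x _; apply: h; exists x].
Qed.

Lemma continuous_integrals (f : continuousType X R) :
  continuous (fun nu : borel_probability X => integrals nu f).
Proof.
move=> mu; apply: (@continuous_comp (borel_probability X)
  {ptws continuousType X R -> R} R (@integrals R X) (fun h => h f)).
  exact: initial_continuous.
exact: (@proj_continuous _ _ f).
Qed.

Lemma cvg_borel_probability (F : set_system (borel_probability X)) mu :
    Filter F ->
    (forall f : continuousType X R,
      integrals nu f @[nu --> F] --> integrals mu f) ->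
  F --> (mu : borel_probability X).
Proof.
move=> FF Ff A [_ [[B oB <-] Bmu BA]].
have Fint : (@integrals R X) nu @[nu --> F] --> integrals mu.
  apply/cvg_sup => f U [V [[W oW <-] Wf WU]].
  apply: (filterS WU); rewrite nbhs_simpl /=.
  by apply: (Ff f); exact: open_nbhs_nbhs.
by apply: filterS BA _; apply: Fint; exact: open_nbhs_nbhs.
Qed.
End BorelMeasures.

Section Portmanteau.
Context {R : realType} {X : pmetricType R}.
Implicit Types (mu nu : probability (borel X) R).

(** The lower semicontinuity half of the portmanteau theorem, in the case of
    mass 0.  Around each point of U stands a continuous tent function supported
    in U; its integral vanishes on M, hence at mu, so that the open set where
    the tent is positive is mu-null. *)
Lemma closure_null_open (M : set (borel_probability X)) mu (U : set X) :
    compact [set: X] -> open U ->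
    (forall nu : probability (borel X) R,
      M (nu : borel_probability X) -> nu U = 0%E) ->
  closure M (mu : borel_probability X) -> mu U = 0%E.
Proof.
move=> cX oU MU Mmu; apply: locally_null => // x Ux.
have [r /= r0 rU] : exists2 r : R, 0 < r & forall y, mdist x y < r -> U y.
  have /nbhs_ballP[r r0 rU] : nbhs x U by exact: open_nbhs_nbhs.
  by exists r => // y xy; apply: rU; rewrite ballEmdist.
pose tent (y : X) : R := Num.max 0 (r - mdist x y).
have ctent : continuous tent.
  move=> y; apply: (@continuous_max R X (fun=> 0) (fun z => r - mdist x z)).
    exact: cvg_cst.
  by apply: cvgB; [exact: cvg_cst|exact: continuous_mdist].
pose f : continuousType X R := mkcts ctent.
have mf : measurable_fun [set: borel X] (EFin \o tent).
  by apply/measurable_EFinP; exact: continuous_measurable_borel.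
have f0 y : 0 <= tent y by rewrite /tent le_max lexx.
have Mf nu : M (nu : borel_probability X) -> integrals nu f = 0.
  move=> /MU nuU; rewrite /integrals /Rintegral.
  rewrite (ae_eq_integral (cst 0%E)) ?integral0//.
  exists U; split=> //; first exact: measurable_open_borel.
  move=> y /= ny; apply: contrapT => nUy; apply: ny => _ /=.
  by congr EFin; apply/max_idPl; rewrite subr_le0 leNgt; apply/negP => /rU.
have muf : integrals mu f = 0.
  have cl0 : closed [set nu : borel_probability X | integrals nu f = 0].
    have /continuous_closedP cl := @continuous_integrals R X f.
    exact: (cl _ (@closed_eq R 0)).
  have := closureS (Mf : M `<=` [set nu | integrals nu f = 0]) Mmu.
  by rewrite -(iffLR (closure_id _) cl0).
have oV : open (tent @^-1` [set t | 0 < t]).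
  by have /continuousP := ctent; apply; exact: open_gt.
pose V := tent @^-1` [set t | 0 < t].
exists V; split.
- exact: oV.
- by rewrite /V/= lt_max mdistxx subr0 r0 orbT.
apply: measure_negligible.
  exact: measurable_open_borel.
have /ae_eq_integral_abs-/(_ mu measurableT)[+ _] := mf.
have -> : (\int[mu]_x `|(EFin \o tent) x|)%E = 0%E.
  under eq_integral do rewrite /= ger0_norm//.
  rewrite -[LHS]fineK; last first.
    exact: integrable_fin_num (integrable_continuous mu cX ctent).
  by congr EFin.
case=> // N [mN N0 hN]; exists N; split=> // y; rewrite /V /= => ty.
by apply: hN => /= /(_ I) [] t0; rewrite t0 ltxx in ty.
Qed.
End Portmanteau.

(** * Approximation by measures with finite support *)

Section Approximation.
Context {R : realType} {X : pmetricType R}.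
Implicit Types (mu : probability (borel X) R).

(** T sends x to the first point of s within r of x, and to the default p when
    there is none. *)
Lemma nearby_point_map (r : R) (p : X) (s : seq X) :
  exists T : {mfun borel X >-> borel X},
    (forall x, T x \in p :: s) /\
    (forall x q, q \in s -> mdist q x < r -> mdist (T x) x < r).
Proof.
elim: s => [|q s [T [Ts Tr]]].
  by exists (cst p : {mfun borel X >-> borel X}); split=> // x; rewrite inE.
pose T' (x : borel X) : borel X := if mdist q x < r then q else T x.
have mT' : measurable_fun setT T'.
  apply: measurable_fun_ifT => //.
  apply: (measurable_fun_bool true); rewrite setTI.
  apply: measurable_open_borel.
  rewrite (_ : _ @^-1` _ = mdist q @^-1` [set t | t < r]).
    by have /continuousP := @continuous_mdist R X q; apply; exact: open_lt.
  by apply/seteqP; split.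
exists (mfun_Sub (mem_set mT')); split=> [x|x q'] /=.
  rewrite /T'; case: ifP => _; first by rewrite !inE eqxx orbT.
  by have := Ts x; rewrite !inE => /orP[->//|->]; rewrite !orbT.
rewrite inE /T'; case: ifPn => // nqx /predU1P[->|q's] q'x; last exact: Tr q'x.
by rewrite q'x in nqx.
Qed.

(** The balls of radius r centred in P cover the compact set closure P;
    finitely many of them suffice. *)
Lemma finite_valued_approximation (P : set X) (r : R) :
    compact [set: X] -> P !=set0 -> 0 < r ->
  exists (T : {mfun borel X >-> borel X}) (s : seq X),
    [/\ forall x, T x \in s, forall y, y \in s -> P y &
        forall x, closure P x -> mdist (T x) x < r].
Proof.
move=> cX [p Pp] r0.
have cP : compact (closure P).
  by apply: subclosed_compact cX _ => //; exact: closed_closure.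
rewrite compact_cover in cP.
have [||D DP cov] := cP X P (fun q => mdist q @^-1` [set t | t < r]).
- move=> q _.
  by have /continuousP := @continuous_mdist R X q; apply; exact: open_lt.
- move=> x Px; have [q [Pq xq]] := Px _ (near_mdist x r0).
  by exists q => //=; rewrite metric_sym.
have [T [Ts Tr]] := nearby_point_map r p (finmap.enum_fset D).
exists T, (p :: finmap.enum_fset D); split=> //.
- by move=> y; rewrite inE => /predU1P[->//|/DP]; rewrite inE.
- by move=> x /cov[q /= qD qx]; exact: Tr qx.
Qed.

(** Almost sure convergence implies convergence in law: for continuous f the
    integrals of f \o T n converge by dominated convergence, f being bounded
    on the compact space X. *)
Lemma cvg_distribution mu (T : {mfun borel X >-> borel X}^nat) :
    compact [set: X] ->
    {ae mu, forall x, (T n x : X) @[n --> \oo] --> (x : X)} ->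
  (distribution mu (T n) : borel_probability X) @[n --> \oo]
    --> (mu : borel_probability X).
Proof.
move=> cX Tcvg; apply: cvg_borel_probability => f.
have cf : continuous f by exact: cts_fun.
have mf := continuous_measurable_borel cf.
have [M hM] : exists M, forall x : X, `|f x| <= M.
  have /compact_bounded[M [_ hM]] : compact (f @` [set: X]).
    by apply: continuous_compact => //; exact: continuous_subspaceT.
  by exists (M + 1) => x; apply: (hM (M + 1)); [rewrite ltrDl|exists x].
have mfT n : measurable_fun [set: borel X] (f \o T n).
  by apply: measurableT_comp.
have ifT n : mu.-integrable [set: borel X] (EFin \o (f \o T n)).
  apply: measurable_bounded_integrable => //.
    by rewrite (le_lt_trans (probability_le1 _ _))// ltry.
  exists M; split; [exact: num_real|move=> N MN x _ /=].
  by rewrite (le_trans (hM _))// ltW.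
suff cvg : (\int[distribution mu (T n)]_x (f x)%:E)%E @[n --> \oo]
    --> (\int[mu]_x (f x)%:E)%E.
  apply: (@fine_cvg _ _ (\oo) _
    (fun n => \int[distribution mu (T n)]_x (f x)%:E)%E).
  by rewrite fineK//; apply: integrable_fin_num => //;
    exact: integrable_continuous.
have E n : (\int[distribution mu (T n)]_x (f x)%:E =
    \int[mu]_x (f (T n x))%:E)%E.
  by rewrite integral_distribution//; [exact/measurable_EFinP|exact: ifT].
rewrite (eq_cvg _ _ E).
have [] := @dominated_convergence _ _ R mu setT measurableT
  (fun n x => (f (T n x))%:E) (EFin \o f) (fun=> M%:E) => //.
- by move=> n; apply/measurable_EFinP; exact: mfT.
- exact/measurable_EFinP.
- apply: filterS Tcvg => x Tx _; apply: cvg_EFin; first exact: nearW.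
  by apply: continuous_cvg => //; exact: cf.
- exact: finite_measure_integrable_cst.
- by apply: aeW => x n _; rewrite lee_fin.
Qed.
End Approximation.

(** * Persistent shadowing and measures *)

Section PersistentShadowing.
Context {R : realType} {G : groupType} {X : pmetricType R}.
Implicit Types (S : set G) (phi psi : G -> X -> X).
Implicit Types (mu : probability (borel X) R).

Lemma PSh_uniform S phi (s : seq X) (e : R) :
    (forall y, y \in s -> PSh S phi y) -> 0 < e ->
  exists2 d : R, 0 < d & forall psi, continuous_action psi ->
    action_dist S phi psi < d -> forall y, y \in s -> Sh S psi d e y.
Proof.
move=> + e0; elim: s => [_|y s ih Ps]; first by exists 1.
have [z zs|d d0 hd] := ih; first by apply: Ps; rewrite inE zs orbT.
have [|d' d'0 hd'] := Ps y _ e e0; first by rewrite inE eqxx.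
exists (Num.min d d'); first by rewrite lt_min d0.
move=> psi cpsi; rewrite lt_min => /andP[pd pd'] z.
have [led led'] : Num.min d d' <= d /\ Num.min d d' <= d'.
  by rewrite !ge_min !lexx orbT.
rewrite inE => /predU1P[->|zs] f pf fz.
  exact: hd' cpsi pd' f (pseudo_orbitW led' pf) fz.
exact: hd cpsi pd z zs f (pseudo_orbitW led pf) fz.
Qed.

(** A set of positive measure contains a value T x, and all the values of T
    are shadowable with one common delta. *)
Lemma M_PSh_distribution S phi mu (T : {mfun borel X >-> borel X}) (s : seq X) :
    (forall x, T x \in s) -> (forall y, y \in s -> PSh S phi y) ->
  M_PSh S phi (distribution mu T : borel_probability X).
Proof.
move=> Ts sP e e0; have [d d0 hd] := PSh_uniform sP e0.
exists d => // A mA A0 psi cpsi dpsi.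
have [x Ax] : T @^-1` A !=set0.
  have : (0 < mu (T @^-1` A))%E by exact: A0.
  by move=> TA; apply/set0P; apply: contraTneq TA => ->; rewrite measure0 ltxx.
by exists (T x); split=> //; exact: hd.
Qed.

(** A point all of whose open neighbourhoods have positive measure is adherent
    to Sh S psi d e for every psi near phi, with d depending on e alone: it is
    persistently shadowable. *)
Lemma M_PSh_null S phi mu :
    compact [set: X] -> finite_set S -> continuous_action phi ->
  M_PSh S phi (mu : borel_probability X) -> mu (~` closure (PSh S phi)) = 0%E.
Proof.
move=> cX fS cphi Mmu.
apply: locally_null => //; first exact/closed_openC/closed_closure.
move=> x xP; apply: contrapT => nV; apply: xP; apply: subset_closure.
apply: PSh_of_adherent_Sh => // e /Mmu[d d0 hd]; exists d => // psi cpsi dpsi U.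
rewrite nbhsE => -[V [oV Vx] VU].
have [||y [Vy Shy]] := hd V _ _ psi cpsi dpsi.
- exact: measurable_open_borel.
- by rewrite lt0e measure_ge0 andbT; apply/eqP => V0; apply: nV; exists V.
by exists y; split=> //; exact: VU.
Qed.
End PersistentShadowing.

Theorem proposition3p10 (R : realType) (G : groupType) (S : set G)
    (hS : finite_generating_set S)
    (X : pmetricType R) (hX : compact [set: X])
    (phi : G -> X -> X) (hphi : continuous_action phi)
    (mu : probability (borel X) R) :
  mu (closure (PSh S phi)) = 1%E <->
  closure (M_PSh S phi) (mu : borel_probability X).
Proof.
have mcl : measurable (closure (PSh S phi) : set (borel X)).
  by apply: measurable_closed_borel; exact: closed_closure.
split=> [mu1|Mmu].
- have mu0 : mu (~` closure (PSh S phi)) = 0%E.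
    by rewrite probability_setC// mu1 subee.
  have P0 : PSh S phi !=set0.
    apply/set0P; apply/eqP => P0; move: mu1.
    by rewrite P0 closure0 measure0 => /eqP; rewrite lt_eqF.
  have r0 n : 0 < n.+1%:R^-1 :> R by rewrite invr_gt0.
  have [T hT] := choice (fun n => finite_valued_approximation hX P0 (r0 n)).
  suff cvgT : {ae mu, forall x, (T n x : X) @[n --> \oo] --> (x : X)}.
    apply: (closed_cvg _ (@closed_closure _ (M_PSh S phi)) _ _
      (cvg_distribution hX cvgT)).
    apply: nearW => n; apply: subset_closure.
    by have [s [Ts sP _]] := hT n; exact: M_PSh_distribution Ts sP.
  exists (~` closure (PSh S phi)); split=> //; first exact: measurableC.
  move=> x /= ncvg Px; apply: ncvg.
  apply/metricType_numDomainType.cvgrPdist_lt => e e0.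
  have := near_infty_natSinv_lt (PosNum e0); apply: filterS => n /=.
  have [s [_ _ Tx]] := hT n; rewrite metric_sym.
  exact: lt_trans (Tx x Px).
- have [fS _] := hS.
  have mu0 : mu (~` closure (PSh S phi)) = 0%E.
    apply: closure_null_open Mmu => //; first exact/closed_openC/closed_closure.
    by move=> nu; exact: M_PSh_null.
  rewrite -[closure _]setCK probability_setC ?mu0 ?sube0//.
  exact: measurableC.
Qed.
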